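(* Consider the set of all real vectors $(\zeta,\tau,\beta,\nu,\omega,\sigma,\psi,\chi,\rho)$ satisfying the constraints (Sec), (McC), (Feed), (Split), (Hex), (Par) listed in the context together with $0\le\zeta_{i,j}\le1$ for $[i,j]\in\mathcal T$, $\chi_{i,j}\ge0$ for $(i,j)\in\mathcal C$ and $\rho_{i,j}\ge0$ for $(i,j)\in\mathcal R$. Then for every vector in this set and every $[i,j]\in\mathcal S$, the subvector consisting of $$\zeta_{i,j},\ (\tau_{i,k,j})_k,\ (\beta_{i,l,j})_l,\ (\sigma_{i,k,l,j})_{k,l},\ (\tau_{i,j,n})_{j+1\le n\le N+1},\ (\beta_{m,i,j})_{0\le m\le i-1},\ (\psi_{i,n,m,j})_{n,m},\ \chi_{i,j},\ \rho_{i,j}$$ (where $\chi_{i,j}$ is omitted if $(i,j)\notin\mathcal C$ and $\rho_{i,j}$ is omitted if $(i,j)\notin\mathcal R$) is contained in the convex hull of the vectors that satisfy at least one of the following conditions, all unspecified components being zero: 1. for some $1\le m\le i-1$, $j+1\le n\le N$ and $i<l\le k+1\le j$: $\zeta_{i,j}=\tau_{i,k,j}=\beta_{i,l,j}=\sigma_{i,k,l,j}=\tau_{i,j,n}=\beta_{m,i,j}=\psi_{i,n,m,j}=1$; 2. for some $j+1\le n\le N$ and $i<l\le k+1\le j$: $\zeta_{i,j}=\tau_{i,k,j}=\beta_{i,l,j}=\sigma_{i,k,l,j}=\tau_{i,j,n}=\beta_{0,i,j}=\psi_{i,n,0,j}=1$, and $\chi_{i,j}\in\{0,1\}$; 3.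 for some $1\le m\le i-1$ and $i<l\le k+1\le j$: $\zeta_{i,j}=\tau_{i,k,j}=\beta_{i,l,j}=\sigma_{i,k,l,j}=\tau_{i,j,N+1}=\beta_{m,i,j}=\psi_{i,N+1,m,j}=1$, and $\rho_{i,j}\in\{0,1\}$; 4. all the variables are zero.
   Context: Let $N\ge2$ be an integer, $\mathcal T=\{[i,j]:1\le i\le j\le N\}$, $\mathcal P=\mathcal T\setminus\{[i,i]:1\le i\le N\}$, $\mathcal S=\mathcal P\setminus\{[1,N]\}$, $\mathcal C=\{(i,j):1\le i\le j\le N-1\}$ and $\mathcal R=\{(i,j):2\le i\le j\le N\}$. Real variables: $\zeta_{i,j}$ for $[i,j]\in\mathcal T$; $\tau_{i,k,j}$ ($i\le k\le j-1$), $\beta_{i,l,j}$ ($i+1\le l\le j$) and $\sigma_{i,k,l,j}$ ($i\le k\le j-1$, $i+1\le l\le k+1$) for $[i,j]\in\mathcal P$; $\nu_{i,k,j}$ for $1\le i\le k\le j\le N$ and $\omega_{i,l,j}$ for $1\le i\le l\le j\le N$; $\psi_{i,n,m,j}$ for $[i,j]\in\mathcal T\setminus\{[1,N]\}$, $j+1\le n\le N+1$, $0\le m\le i-1$; $\chi_{i,j}$ for $(i,j)\in\mathcal C$; $\rho_{i,j}$ for $(i,j)\in\mathcal R$. Conventions: $\nu_{i,n,m}:=1$ if $n=m+1$, and $\omega_{n,m,j}:=1$ if $n=m+1$. In addition, for $[i,j]\in\mathcal T$ define $\tau_{i,j,N+1}:=\nu_{i,j+1,N}-\nu_{i,j,N}$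 and $\beta_{0,i,j}:=\omega_{1,i-1,j}-\omega_{1,i,j}$. (Sec) For all $[i,j]\in\mathcal P$: $\tau_{i,k,j}=\nu_{i,k+1,j-1}-\nu_{i,k,j-1}-\nu_{i,k+1,j}+\nu_{i,k,j}$ for $i\le k\le j-1$; and $\beta_{i,l,j}=\omega_{i+1,l-1,j}-\omega_{i,l-1,j}-\omega_{i+1,l,j}+\omega_{i,l,j}$ for $i+1\le l\le j$. (McC) $\nu_{i,j,j}=\omega_{i,i,j}=1-\zeta_{i,j}$ for all $[i,j]\in\mathcal T$. For all $[i,j]\in\mathcal P$: $\max\{0,\nu_{i,k,m}+\nu_{i,n,j}-\nu_{i,n,m}\}\le\nu_{i,k,j}\le\min\{\nu_{i,k,m},\nu_{i,n,j}\}$ for all $i\le k\le j-1$, $k\le m\le j-1$, $k+1\le n\le m+1$; and $\max\{0,\omega_{i,m,j}+\omega_{n,l,j}-\omega_{n,m,j}\}\le\omega_{i,l,j}\le\min\{\omega_{i,m,j},\omega_{n,l,j}\}$ for all $i+1\le l\le j$, $i\le m\le l-1$, $i+1\le n\le m+1$. (Feed) $\zeta_{1,N}=1$ and $\zeta_{i,i}=1$ for $i=1,\dots,N$. (Split) For all $[i,j]\in\mathcal P$: $\sum_{l=i+1}^{k+1}\sigma_{i,k,l,j}=\tau_{i,k,j}$ for $i\le k\le j-1$; $\sum_{k=l-1}^{j-1}\sigma_{i,k,l,j}=\beta_{i,l,j}$ for $i+1\le l\le j$; and $\sigma_{i,k,l,j}\ge0$ for $i\le k\le j-1$, $i+1\le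 l\le k+1$. (Hex) $\chi_{i,j}\le\beta_{0,i,j}$ for $(i,j)\in\mathcal C$; $\rho_{i,j}\le\tau_{i,j,N+1}$ for $(i,j)\in\mathcal R$; $\chi_{i,i}\ge\beta_{0,i,i}$ for $(i,i)\in\mathcal C$; $\rho_{i,i}\ge\tau_{i,i,N+1}$ for $(i,i)\in\mathcal R$. (Par) For all $[i,j]\in\mathcal T\setminus\{[1,N]\}$: $\sum_{m=0}^{i-1}\psi_{i,n,m,j}=\tau_{i,j,n}$ for $j+1\le n\le N+1$; $\sum_{n=j+1}^{N+1}\psi_{i,n,m,j}=\beta_{m,i,j}$ for $0\le m\le i-1$; $\psi_{i,n,m,j}\ge0$ for all $j+1\le n\le N+1$, $0\le m\le i-1$; and $\psi_{i,N+1,0,j}=0$. *)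

(* Defs.v *)
From mathcomp Require Import all_boot all_order all_algebra.
From mathcomp Require Import all_classical all_reals.

Set Implicit Arguments.
Unset Strict Implicit.
Unset Printing Implicit Defensive.

Import Order.TTheory GRing.Theory Num.Theory.
Local Open Scope classical_set_scope.
Local Open Scope ring_scope.

Section IndexSets.
Local Open Scope nat_scope.
Implicit Types N i j : nat.

Definition in_T N i j : bool := [&& 1 <= i, i <= j & j <= N].
Definition in_P N i j : bool := in_T N i j && (i != j).
Definition is_root N i j : bool := (i == 1) && (j == N).
Definition in_S N i j : bool := in_P N i j && ~~ is_root N i j.
Definition in_C N i j : bool := [&& 1 <= i, i <= j & j <= N.-1].
Definition in_R N i j : bool := [&& 2 <= i, i <= j & j <= N].

End IndexSets.

(* All index families are 1-based and stored as total functions on [nat], with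
   the arguments in the order of the subscripts. Entries outside the index
   ranges are junk: no constraint and no subvector mentions them. [nu_var],
   [omega_var], [tau_var] and [beta_var] hold the genuine variables only; [nu],
   [omega], [tau] and [beta] below add the boundary conventions. *)
Record variables (R : realType) := Variables {
  zeta : nat -> nat -> R;
  tau_var : nat -> nat -> nat -> R;
  beta_var : nat -> nat -> nat -> R;
  nu_var : nat -> nat -> nat -> R;
  omega_var : nat -> nat -> nat -> R;
  sigma : nat -> nat -> nat -> nat -> R;
  psi : nat -> nat -> nat -> nat -> R;
  chi : nat -> nat -> R;
  rho : nat -> nat -> R
}.

Section Constraints.
Variables (R : realType) (N : nat) (x : variables R).

Definition nu (i n m : nat) : R := if n == m.+1 then 1 else nu_var x i n m.
Definition omega (n m j : nat) : R := if n == m.+1 then 1 else omega_var x n m j.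

Definition tau (i k j : nat) : R :=
  if j == N.+1 then nu i k.+1 N - nu i k N else tau_var x i k j.
Definition beta (i l j : nat) : R :=
  if i == 0%N then omega 1%N l.-1 j - omega 1%N l j else beta_var x i l j.

Definition Sec : Prop := forall i j, in_P N i j ->
  (forall k, (i <= k <= j.-1)%N ->
     tau i k j = nu i k.+1 j.-1 - nu i k j.-1 - nu i k.+1 j + nu i k j) /\
  (forall l, (i.+1 <= l <= j)%N ->
     beta i l j =
       omega i.+1 l.-1 j - omega i l.-1 j - omega i.+1 l j + omega i l j).

Definition McC : Prop :=
  (forall i j, in_T N i j ->
     nu i j j = 1 - zeta x i j /\ omega i i j = 1 - zeta x i j) /\
  (forall i j, in_P N i j ->
     (forall k m n,
        (i <= k <= j.-1)%N -> (k <= m <= j.-1)%N -> (k.+1 <= n <= m.+1)%N ->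
        Num.max 0 (nu i k m + nu i n j - nu i n m) <= nu i k j
          <= Num.min (nu i k m) (nu i n j)) /\
     (forall l m n,
        (i.+1 <= l <= j)%N -> (i <= m <= l.-1)%N -> (i.+1 <= n <= m.+1)%N ->
        Num.max 0 (omega i m j + omega n l j - omega n m j) <= omega i l j
          <= Num.min (omega i m j) (omega n l j))).

Definition Feed : Prop :=
  zeta x 1%N N = 1 /\ forall i, (1 <= i <= N)%N -> zeta x i i = 1.

Definition Split : Prop := forall i j, in_P N i j ->
  [/\ forall k, (i <= k <= j.-1)%N ->
        \sum_(i.+1 <= l < k.+2) sigma x i k l j = tau i k j,
      forall l, (i.+1 <= l <= j)%N ->
        \sum_(l.-1 <= k < j) sigma x i k l j = beta i l j
    & forall k l, (i <= k <= j.-1)%N -> (i.+1 <= l <= k.+1)%N ->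
        0 <= sigma x i k l j].

Definition Hex : Prop :=
  [/\ forall i j, in_C N i j -> chi x i j <= beta 0%N i j,
      forall i j, in_R N i j -> rho x i j <= tau i j N.+1,
      forall i, in_C N i i -> beta 0%N i i <= chi x i i
    & forall i, in_R N i i -> tau i i N.+1 <= rho x i i].

Definition Par : Prop := forall i j, in_T N i j -> ~~ is_root N i j ->
  [/\ forall n, (j.+1 <= n <= N.+1)%N ->
        \sum_(0 <= m < i) psi x i n m j = tau i j n,
      forall m, (0 <= m <= i.-1)%N ->
        \sum_(j.+1 <= n < N.+2) psi x i n m j = beta m i j,
      forall n m, (j.+1 <= n <= N.+1)%N -> (0 <= m <= i.-1)%N ->
        0 <= psi x i n m j
    & psi x i N.+1 0%N j = 0].

Definition Bounds : Prop :=
  [/\ forall i j, in_T N i j -> 0 <= zeta x i j <= 1,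
      forall i j, in_C N i j -> 0 <= chi x i j
    & forall i j, in_R N i j -> 0 <= rho x i j].

Definition feasible : Prop := [/\ Sec, McC, Feed & Split] /\ [/\ Hex, Par & Bounds].

End Constraints.

(* Names of the coordinates of the subvector attached to [i,j]: [CTau k],
   [CBeta l] and [CSigma k l] stand for tau_{i,k,j}, beta_{i,l,j} and
   sigma_{i,k,l,j}; [CTauPar n], [CBetaPar m] and [CPsi n m] stand for
   tau_{i,j,n}, beta_{m,i,j} and psi_{i,n,m,j}. *)
Inductive coord :=
  | CZeta
  | CTau of nat
  | CBeta of nat
  | CSigma of nat & nat
  | CTauPar of nat
  | CBetaPar of nat
  | CPsi of nat & nat
  | CChi
  | CRho.

Definition in_range (N i j : nat) (c : coord) : bool :=
  match c with
  | CZeta => true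
  | CTau k => (i <= k <= j.-1)%N
  | CBeta l => (i.+1 <= l <= j)%N
  | CSigma k l => (i <= k <= j.-1)%N && (i.+1 <= l <= k.+1)%N
  | CTauPar n => (j.+1 <= n <= N.+1)%N
  | CBetaPar m => (0 <= m <= i.-1)%N
  | CPsi n m => (j.+1 <= n <= N.+1)%N && (0 <= m <= i.-1)%N
  | CChi => in_C N i j
  | CRho => in_R N i j
  end.

Definition local_space (R : realType) (N i j : nat) : lmodType R :=
  ({c : coord | in_range N i j c} -> R^o).

Definition subvector (R : realType) (N : nat) (x : variables R) (i j : nat) :
    local_space R N i j := fun c =>
  match sval c with
  | CZeta => zeta x i j
  | CTau k => tau N x i k j
  | CBeta l => beta x i l j
  | CSigma k l => sigma x i k l j
  | CTauPar n => tau N x i j n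
  | CBetaPar m => beta x m i j
  | CPsi n m => psi x i n m j
  | CChi => chi x i j
  | CRho => rho x i j
  end.

(* The 0/1 vector with zeta_{i,j} = tau_{i,k,j} = beta_{i,l,j} = sigma_{i,k,l,j}
   = tau_{i,j,n} = beta_{m,i,j} = psi_{i,n,m,j} = 1, chi_{i,j} = c,
   rho_{i,j} = r and all other components zero. *)
Definition point (R : realType) (N i j k l n m : nat) (c r : R) :
    local_space R N i j := fun u =>
  match sval u with
  | CZeta => 1
  | CTau k' => (k' == k)%:R
  | CBeta l' => (l' == l)%:R
  | CSigma k' l' => ((k' == k) && (l' == l))%:R
  | CTauPar n' => (n' == n)%:R
  | CBetaPar m' => (m' == m)%:R
  | CPsi n' m' => ((n' == n) && (m' == m))%:R
  | CChi => c
  | CRho => r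
  end.

Arguments subvector {R} N x i j _.
Arguments point {R} N i j k l n m c r _.

Section Conditions.
Variables (R : realType) (N i j : nat).
Implicit Type v : local_space R N i j.

Definition split_ok (k l : nat) : bool := [&& i < l, l <= k.+1 & k.+1 <= j]%N.

Definition condition1 : set (local_space R N i j) := [set v |
  exists m n k l, [/\ (1 <= m <= i.-1)%N, (j.+1 <= n <= N)%N, split_ok k l
    & v = point N i j k l n m 0 0]].

Definition condition2 : set (local_space R N i j) := [set v |
  exists n k l (c : R), [/\ (j.+1 <= n <= N)%N, split_ok k l, c = 0 \/ c = 1
    & v = point N i j k l n 0%N c 0]].

Definition condition3 : set (local_space R N i j) := [set v |
  exists m k l (r : R), [/\ (1 <= m <= i.-1)%N, split_ok k l, r = 0 \/ r = 1
    & v = point N i j k l N.+1 m 0 r]].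

Definition condition4 : set (local_space R N i j) := [set 0].

Definition generators : set (local_space R N i j) :=
  condition1 `|` condition2 `|` condition3 `|` condition4.

End Conditions.

Arguments generators R N i j _ : clear implicits.

Definition convex_hull (R : realType) (V : lmodType R) (A : set V) : set V :=
  [set v | exists (n : nat) (w : 'I_n -> R) (a : 'I_n -> V),
    [/\ forall s, 0 <= w s, \sum_(s < n) w s = 1, forall s, A (a s)
      & v = \sum_(s < n) w s *: a s]].

(* Main.v *)
(** Telescoping (Sec) and using [zeta_{i,i} = 1] shows that each of the families
    [tau_{i,.,j}], [beta_{i,.,j}], [tau_{i,j,.}] and [beta_{.,i,j}] sums to
    [zeta_{i,j}]. Hence [sigma] and [psi] are nonnegative arrays of the same total
    mass [zeta_{i,j}] with these families as marginals, and their product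
    divided by [zeta_{i,j}] is a coupling; [chi] and [rho] are realised by
    splitting the [m = 0] and [n = N+1] masses of [psi] in the proportions
    [chi / beta_0] and [rho / tau_{N+1}]. The missing mass [1 - zeta_{i,j}] is
    put on the zero vector. *)
Require Import Defs.
From mathcomp Require Import all_boot all_order all_algebra.
From mathcomp Require Import all_classical all_reals.
From mathcomp Require Import zify lra.

Set Implicit Arguments.
Unset Strict Implicit.
Unset Printing Implicit Defensive.

Import Order.TTheory GRing.Theory Num.Theory.
Local Open Scope ring_scope.

(** * Convex combinations with slack, masked sums and marginals of product arrays *)

Section FiniteSums.
Variable R : realType.

(** An extra index [ord0] puts the missing mass [1 - \sum_s w s] on [0]. Points of zero weight are
    replaced by [0], so membership in [A] matters only where the weight is nonzero. *)
Lemma convex_hull_le1 (V : lmodType R) (A : set V) (I : finType)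
    (w : I -> R) (a : I -> V) :
  A 0 -> (forall s, 0 <= w s) -> \sum_s w s <= 1 ->
  (forall s, w s != 0 -> A (a s)) -> convex_hull A (\sum_s w s *: a s).
Proof.
move=> A0 w0 w1 Aa.
exists #|I|.+1, (fun s => oapp (w \o enum_val) (1 - \sum_s w s) (unlift ord0 s)).
exists (fun s => oapp (fun r => if w (enum_val r) == 0 then 0 else a (enum_val r))
  0 (unlift ord0 s)); split.
- by move=> s; case: unliftP => [r _|_] /=; rewrite ?subr_ge0 ?w0.
- rewrite big_ord_recl unlift_none /=.
  under [X in _ + X]eq_bigr do rewrite liftK /=.
  by rewrite -(big_enum_val (fun r => w r)) subrK.
- move=> s; case: unliftP => [r _|_] //=.
  by case: eqP => // /eqP wr; apply: Aa.
- rewrite big_ord_recl unlift_none /= scaler0 add0r.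
  under [RHS]eq_bigr do rewrite liftK /=.
  rewrite -(big_enum_val (fun r => w r *: (if w r == 0 then 0 else a r))).
  by apply: eq_bigr => r _; case: eqP => // ->; rewrite !scale0r.
Qed.

(** Brings all index ranges, which depend on [i], [j] and each other, to one finite type, so that
    product types can index the coupling. *)
Lemma sum_nat_mask M a b (F : nat -> R) : (b <= M)%N ->
  \sum_(a <= l < b) F l = \sum_(l < M) (if (a <= l < b)%N then F l else 0).
Proof.
move=> bM; rewrite (big_nat_widen _ _ _ _ _ bM) big_geq_mkord big_mkcond /=.
by apply: eq_bigr => l _; rewrite andbC.
Qed.

Lemma sum_pair_fst M k (F : nat -> nat -> R) : (k < M)%N ->
  \sum_(a : 'I_M * 'I_M) F a.1 a.2 * (k == a.1)%:R = \sum_(l < M) F k l.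
Proof.
move=> kM; rewrite -(pair_bigA _ (fun c d : 'I_M => F c d * (k == c :> nat)%:R)) /=.
rewrite (bigD1 (Ordinal kM)) //= [X in _ + X]big1 ?addr0.
  by apply: eq_bigr => l _; rewrite eqxx mulr1.
move=> c /negbTE cE; apply: big1 => l _.
by move: cE; rewrite -val_eqE /= eq_sym => ->; rewrite mulr0.
Qed.

Lemma sum_pair_snd M l (F : nat -> nat -> R) : (l < M)%N ->
  \sum_(a : 'I_M * 'I_M) F a.1 a.2 * (l == a.2)%:R = \sum_(k < M) F k l.
Proof.
move=> lM; rewrite -(sum_pair_fst (fun c d => F d c) lM).
rewrite (reindex_inj (h := fun a : 'I_M * 'I_M => (a.2, a.1))) //=.
by move=> [? ?] [? ?] [-> ->].
Qed.

Lemma sum_pair_both M k l (F : nat -> nat -> R) : (k < M)%N -> (l < M)%N ->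
  \sum_(a : 'I_M * 'I_M) F a.1 a.2 * ((k == a.1) && (l == a.2))%:R = F k l.
Proof.
move=> kM lM; rewrite (bigD1 (Ordinal kM, Ordinal lM)) //= !eqxx mulr1.
rewrite big1 ?addr0 // => -[c d] /negbTE; rewrite xpair_eqE -!val_eqE /=.
by rewrite eq_sym [X in _ && X]eq_sym => ->; rewrite mulr0.
Qed.

Lemma sum_product_fst (A B : finType) (s : A -> R) (p : B -> R) (z : R)
    (h : A -> R) :
  (forall a, 0 <= s a) -> \sum_a s a = z -> \sum_b p b = z ->
  \sum_(u : A * B) s u.1 * p u.2 / z * h u.1 = \sum_a s a * h a.
Proof.
move=> s0 sz pz.
rewrite -(pair_bigA _ (fun a b => s a * p b / z * h a)) /=; apply: eq_bigr => a _.
rewrite -mulr_suml -mulr_suml -mulr_sumr pz.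
(* If [z = 0], nonnegativity forces every [s a] to vanish, so the default value of [z^-1] is
   harmless. *)
have [z0|z0] := eqVneq z 0; last by rewrite mulfK.
have/psumr_eq0P -> // : \sum_a s a = 0 by rewrite sz.
by rewrite !mul0r.
Qed.

Lemma sum_product_snd (A B : finType) (s : A -> R) (p : B -> R) (z : R)
    (h : B -> R) :
  (forall b, 0 <= p b) -> \sum_a s a = z -> \sum_b p b = z ->
  \sum_(u : A * B) s u.1 * p u.2 / z * h u.2 = \sum_b p b * h b.
Proof.
move=> p0 sz pz; rewrite -(sum_product_fst h p0 pz sz).
rewrite (reindex (fun u : B * A => (u.2, u.1))) /=; last first.
  by exists (fun u => (u.2, u.1)) => -[].
by apply: eq_bigr => u _; rewrite (mulrC (s _)).
Qed.

Lemma sum_split_bool (B : finType) (p t : B -> R) (h : B -> bool -> R) :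
  \sum_(v : B * bool) p v.1 * (if v.2 then t v.1 else 1 - t v.1) * h v.1 v.2 =
  \sum_b p b * (t b * h b true + (1 - t b) * h b false).
Proof.
rewrite -(pair_bigA _ (fun b c => p b * (if c then t b else 1 - t b) * h b c)) /=.
by apply: eq_bigr => b _; rewrite big_bool /= -!mulrA -mulrDr.
Qed.

End FiniteSums.

(** * Each family of children or parents sums to [zeta] *)

Section Telescoping.
Variables (R : realType) (N : nat) (x : variables R).
Hypothesis hx : feasible N x.

(** Since [zeta x i i = 1], the value at [j = i] is 0; (McC) with [k = m = i] and [n = i.+1] then
    squeezes [nu x i i j] between 0 and [nu x i i i]. *)
Lemma nu_first i j : (1 <= i)%N -> (i <= j)%N -> (j <= N)%N -> nu x i i j = 0.
Proof.
case: hx => -[_ [hd hm] [_ hz] _] _ i1 ij jN.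
have nuii : nu x i i i = 0.
  by rewrite (proj1 (hd i i _)) ?hz ?subrr // /in_T; lia.
have [<-//|ne] := eqVneq i j.
have Pij : in_P N i j by rewrite /in_P /in_T; lia.
have := (hm i j Pij).1 i i i.+1; rewrite nuii ge_max le_min.
by move=> /(_ ltac:(lia) ltac:(lia) ltac:(lia)) /andP[/andP[? _] /andP[? _]]; lra.
Qed.

Lemma omega_last i j : (1 <= i)%N -> (i <= j)%N -> (j <= N)%N -> omega x i j j = 0.
Proof.
case: hx => -[_ [hd hm] [_ hz] _] _ i1 ij jN.
have omjj : omega x j j j = 0.
  by rewrite (proj2 (hd j j _)) ?hz ?subrr // /in_T; lia.
have [->//|ne] := eqVneq i j.
have Pij : in_P N i j by rewrite /in_P /in_T; lia.
have := (hm i j Pij).2 j j.-1 j; rewrite omjj ge_max le_min.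
by move=> /(_ ltac:(lia) ltac:(lia) ltac:(lia)) /andP[/andP[? _] /andP[_ ?]]; lra.
Qed.

Lemma sum_tau_child i j : in_P N i j -> \sum_(i <= k < j) tau N x i k j = zeta x i j.
Proof.
move=> Pij; case: hx => -[hs [hd _] _ _] _.
have [i1 ij jN] : [/\ (1 <= i)%N, (i < j)%N & (j <= N)%N].
  by move: Pij; rewrite /in_P /in_T; split; lia.
(* The lower end vanishes by [nu_first]; the upper end is [nu x i j j.-1 - nu x i j j], which is
   [1 - (1 - zeta x i j)] by the convention on [nu]. *)
rewrite (@telescope_sumr_eq _ _ _ (fun k => nu x i k j.-1 - nu x i k j)) 1?ltnW//.
  rewrite (proj1 (hd i j _)); last by rewrite /in_T; lia.
  rewrite !nu_first; [|lia..].
  by rewrite /nu prednK ?eqxx; [lra | lia].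
by move=> k kij; rewrite (hs i j Pij).1; [lra | lia].
Qed.

Lemma sum_beta_child i j : in_P N i j -> \sum_(i.+1 <= l < j.+1) beta x i l j = zeta x i j.
Proof.
move=> Pij; case: hx => -[hs [hd _] _ _] _.
have [i1 ij jN] : [/\ (1 <= i)%N, (i < j)%N & (j <= N)%N].
  by move: Pij; rewrite /in_P /in_T; split; lia.
rewrite (@telescope_sumr_eq _ _ _ (fun l => omega x i l.-1 j - omega x i.+1 l.-1 j)) ?ltnS 1?ltnW//.
  rewrite /= (proj2 (hd i j _)); last by rewrite /in_T; lia.
  rewrite !omega_last; [|lia..].
  by rewrite /omega eqxx; lra.
by move=> l lij; rewrite (hs i j Pij).2 /=; [lra | lia].
Qed.

Lemma sum_tau_parent i j : in_T N i j ->
  \sum_(j.+1 <= n < N.+2) tau N x i j n = zeta x i j.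
Proof.
move=> Tij; case: hx => -[hs [hd _] _ _] _.
have [i1 ij jN] : [/\ (1 <= i)%N, (i <= j)%N & (j <= N)%N].
  by move: Tij; rewrite /in_T; split; lia.
(* The term [n = N.+1] is not covered by (Sec): by its definition it cancels the upper end of the
   telescoped sum over [n <= N]. *)
rewrite big_nat_recr //=.
rewrite (@telescope_sumr_eq _ _ _ (fun n => nu x i j n.-1 - nu x i j.+1 n.-1)) //=.
  rewrite (proj1 (hd i j _)) //.
  have -> : nu x i j.+1 j = 1 by rewrite /nu eqxx.
  by rewrite /tau eqxx; lra.
move=> n nij; rewrite (hs i n _).1; first by rewrite /=; lra.
  by rewrite /in_P /in_T; lia.
by lia.
Qed.

Lemma sum_beta_parent i j : in_T N i j ->
  \sum_(0 <= m < i) beta x m i j = zeta x i j.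
Proof.
move=> Tij; case: hx => -[hs [hd _] _ _] _.
have [i1 ij jN] : [/\ (1 <= i)%N, (i <= j)%N & (j <= N)%N].
  by move: Tij; rewrite /in_T; split; lia.
rewrite big_ltn //.
rewrite (@telescope_sumr_eq _ _ _ (fun m => omega x m i.-1 j - omega x m i j)) //=.
  rewrite (proj2 (hd i j _)) //.
  have -> : omega x i i.-1 j = 1 by rewrite /omega prednK ?eqxx.
  by rewrite /beta eqxx; lra.
move=> m mij; rewrite (hs m j _).2; first by rewrite /=; lra.
  by rewrite /in_P /in_T; lia.
by lia.
Qed.

End Telescoping.

(** * The arrays [sigma] and [psi] as masses, and their marginals *)

Section Coupling.
Variables (R : realType) (N : nat) (x : variables R) (i j : nat).
Hypotheses (hx : feasible N x) (hij : in_S N i j).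

(** Like [parent_mass] below, extended by zero outside the index range, so that sums may run over
    ['I_N.+2], which contains the index [N.+1]. *)
Definition split_mass (k l : nat) : R :=
  if split_ok i j k l then sigma x i k l j else 0.

Definition parent_mass (n m : nat) : R :=
  if (j < n < N.+2)%N && (m < i)%N then psi x i n m j else 0.

(* Conditional probability that [chi] (if [m = 0]) or [rho] (if [n = N+1]) is
   one; the junk entries [chi] for [j = N] and [rho] for [i = 1] are harmless
   since their denominator vanishes. *)
Definition share (n m : nat) : R :=
  if m == 0%N then chi x i j / beta x 0 i j
  else if n == N.+1 then rho x i j / tau N x i j N.+1 else 0.

Let i_gt0 : (0 < i)%N.
Proof. by move: hij; rewrite /in_S /in_P /in_T; lia. Qed.

Let ltij : (i < j)%N.
Proof. by move: hij; rewrite /in_S /in_P /in_T; lia. Qed.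

Let lejN : (j <= N)%N.
Proof. by move: hij; rewrite /in_S /in_P /in_T; lia. Qed.

Let Pij : in_P N i j.
Proof. by case/andP: hij. Qed.

Let Tij : in_T N i j.
Proof. by case/andP: Pij. Qed.

Let not_root : ~~ is_root N i j.
Proof. by case/andP: hij. Qed.

Lemma split_mass_ge0 k l : 0 <= split_mass k l.
Proof.
case: hx => -[_ _ _ hS] _; have [_ _ s0] := hS i j Pij.
rewrite /split_mass /split_ok; case: ifP => // kl.
by apply: s0; lia.
Qed.

Lemma sum_split_mass_l k :
  \sum_(l < N.+2) split_mass k l = if (i <= k < j)%N then tau N x i k j else 0.
Proof.
case: hx => -[_ _ _ hS] _; have [hk _ _] := hS i j Pij.
case: ifP => kij; last first.
  by apply: big1 => l _; rewrite /split_mass /split_ok ifF //; lia.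
rewrite -hk; last by lia.
rewrite (@sum_nat_mask _ N.+2); last by lia.
by apply: eq_bigr => l _; rewrite /split_mass /split_ok; congr (if _ then _ else _); lia.
Qed.

Lemma sum_split_mass_k l :
  \sum_(k < N.+2) split_mass k l = if (i < l <= j)%N then beta x i l j else 0.
Proof.
case: hx => -[_ _ _ hS] _; have [_ hl _] := hS i j Pij.
case: ifP => lij; last first.
  by apply: big1 => k _; rewrite /split_mass /split_ok ifF //; lia.
rewrite -hl; last by lia.
rewrite (@sum_nat_mask _ N.+2); last by lia.
by apply: eq_bigr => k _; rewrite /split_mass /split_ok; congr (if _ then _ else _); lia.
Qed.

Lemma sum_split_mass :
  \sum_(a : 'I_N.+2 * 'I_N.+2) split_mass a.1 a.2 = zeta x i j.
Proof.
rewrite -(pair_bigA _ (fun k l : 'I_N.+2 => split_mass k l)) /=.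
under eq_bigr do rewrite sum_split_mass_l.
rewrite -(sum_tau_child hx Pij) (@sum_nat_mask _ N.+2) //; lia.
Qed.

Lemma parent_mass_ge0 n m : 0 <= parent_mass n m.
Proof.
case: hx => _ [_ hP _]; have [_ _ p0 _] := hP i j Tij not_root.
by rewrite /parent_mass; case: ifP => // nm; apply: p0; lia.
Qed.

Lemma parent_mass_root : parent_mass N.+1 0 = 0.
Proof.
case: hx => _ [_ hP _]; have [_ _ _ p0] := hP i j Tij not_root.
by rewrite /parent_mass p0; case: ifP.
Qed.

Lemma sum_parent_mass_m n :
  \sum_(m < N.+2) parent_mass n m = if (j < n < N.+2)%N then tau N x i j n else 0.
Proof.
case: hx => _ [_ hP _]; have [hn _ _ _] := hP i j Tij not_root.
rewrite /parent_mass; case: ifP => nj; last by apply: big1.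
rewrite -hn; last by lia.
by rewrite (@sum_nat_mask _ N.+2) //; lia.
Qed.

Lemma sum_parent_mass_n m :
  \sum_(n < N.+2) parent_mass n m = if (m < i)%N then beta x m i j else 0.
Proof.
case: hx => _ [_ hP _]; have [_ hm _ _] := hP i j Tij not_root.
rewrite /parent_mass; case: ifP => mi; last first.
  by apply: big1 => n _; rewrite andbF.
rewrite -hm; last by lia.
by rewrite (@sum_nat_mask _ N.+2) //; apply: eq_bigr => n _; rewrite andbT.
Qed.

Lemma sum_parent_mass :
  \sum_(b : 'I_N.+2 * 'I_N.+2) parent_mass b.1 b.2 = zeta x i j.
Proof.
rewrite -(pair_bigA _ (fun n m : 'I_N.+2 => parent_mass n m)) /=.
under eq_bigr do rewrite sum_parent_mass_m.
by rewrite -(sum_tau_parent hx Tij) (@sum_nat_mask _ N.+2).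
Qed.

(** For [j = N] the only parent index is [n = N.+1], and (Par) forbids it together with [m = 0]. *)
Lemma beta_root_eq0 : (N <= j)%N -> beta x 0 i j = 0.
Proof.
move=> Nj; have -> : beta x 0 i j = if (0 < i)%N then beta x 0 i j else 0.
  by rewrite i_gt0.
rewrite -sum_parent_mass_n big1 // => n _.
have [nN|nN] := eqVneq (n : nat) N.+1; first by rewrite nN parent_mass_root.
by rewrite /parent_mass ifF //; have := ltn_ord n; lia.
Qed.

Lemma tau_root_eq0 : (i <= 1)%N -> tau N x i j N.+1 = 0.
Proof.
move=> i1; have -> : tau N x i j N.+1
    = if (j < N.+1 < N.+2)%N then tau N x i j N.+1 else 0.
  by rewrite ifT //; lia.
rewrite -sum_parent_mass_m big1 // => m _.
have [m0|m0] := eqVneq (m : nat) 0%N; first by rewrite m0 parent_mass_root.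
by rewrite /parent_mass ifF //; lia.
Qed.

(** * Realising [chi] and [rho] by conditional probabilities *)

Lemma chi_bounds : in_C N i j -> 0 <= chi x i j <= beta x 0 i j.
Proof. by case: hx => _ [[hc _ _ _] _ [_ c0 _]] C; rewrite c0 ?hc. Qed.

Lemma rho_bounds : in_R N i j -> 0 <= rho x i j <= tau N x i j N.+1.
Proof. by case: hx => _ [[_ hr _ _] _ [_ _ r0]] C; rewrite r0 ?hr. Qed.

Lemma share_bounds n m : 0 <= share n m <= 1.
Proof.
have frac (a b : R) : b = 0 \/ 0 <= a <= b -> 0 <= a / b <= 1.
  case=> [->|/andP[a0 ab]]; first by rewrite invr0 mulr0 lexx ler01.
  have [b0|b0] := eqVneq b 0; first by rewrite b0 invr0 mulr0 lexx ler01.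
  have bp : 0 < b by rewrite lt_neqAle eq_sym b0 (le_trans a0 ab).
  by rewrite divr_ge0 ?(ltW bp) //= ler_pdivrMr // mul1r.
rewrite /share; case: ifP => _.
  apply: frac; have [Nj|jN] := leqP N j; first by left; apply: beta_root_eq0.
  by right; apply: chi_bounds; rewrite /in_C; lia.
case: ifP => _; last by rewrite lexx ler01.
apply: frac; have [i1|i1] := leqP i 1; first by left; apply: tau_root_eq0.
by right; apply: rho_bounds; rewrite /in_R; lia.
Qed.

Lemma sum_share_chi : in_C N i j ->
  \sum_(b : 'I_N.+2 * 'I_N.+2) parent_mass b.1 b.2 * share b.1 b.2 * (0%N == b.2)%:R
    = chi x i j.
Proof.
move=> C; rewrite (sum_pair_snd (fun n m => parent_mass n m * share n m)) //.
rewrite /share eqxx -mulr_suml sum_parent_mass_n i_gt0.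
have /andP[c0 cb] := chi_bounds C.
(* A zero denominator forces [chi x i j = 0] by (Hex), which agrees with the default quotient. *)
have [b0|b0] := eqVneq (beta x 0 i j) 0; last by rewrite mulrC divfK.
by rewrite b0 mul0r; apply/le_anti; rewrite c0 -b0 cb.
Qed.

Lemma sum_share_rho : in_R N i j ->
  \sum_(b : 'I_N.+2 * 'I_N.+2)
     parent_mass b.1 b.2 * share b.1 b.2 * (N.+1 == b.1)%:R = rho x i j.
Proof.
move=> C; rewrite (sum_pair_fst (fun n m => parent_mass n m * share n m)) //.
(* On the row [n = N.+1] the share differs in form from this quotient only at [m = 0], where the
   mass is zero. *)
transitivity (\sum_(m < N.+2) parent_mass N.+1 m * (rho x i j / tau N x i j N.+1)).
  apply: eq_bigr => m _; rewrite /share eqxx.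
  by case: eqP => // ->; rewrite parent_mass_root !mul0r.
rewrite -mulr_suml sum_parent_mass_m ifT; last by lia.
have /andP[r0 rt] := rho_bounds C.
have [t0|t0] := eqVneq (tau N x i j N.+1) 0; last by rewrite mulrC divfK.
by rewrite t0 mul0r; apply/le_anti; rewrite r0 -t0 rt.
Qed.

(** * The product coupling and its support *)

Let K : finType := ('I_N.+2 * 'I_N.+2)%type.

(** Given [zeta], the split [(k, l)] is independent of the parent [(n, m)]. The boolean tells
    whether [chi] or [rho] is switched on; one bit suffices because the only cell that would involve
    both, [(N.+1, 0)], has no mass. *)
Definition joint_weight (u : K * (K * bool)) : R :=
  split_mass u.1.1 u.1.2
  * (parent_mass u.2.1.1 u.2.1.2
     * (if u.2.2 then share u.2.1.1 u.2.1.2 else 1 - share u.2.1.1 u.2.1.2))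
  / zeta x i j.

Definition joint_point (u : K * (K * bool)) : local_space R N i j :=
  Defs.point N i j u.1.1 u.1.2 u.2.1.1 u.2.1.2
    ((0%N == u.2.1.2) && u.2.2)%:R ((N.+1 == u.2.1.1) && u.2.2)%:R.

Let parent_weight (v : K * bool) : R := parent_mass v.1.1 v.1.2
  * (if v.2 then share v.1.1 v.1.2 else 1 - share v.1.1 v.1.2).

Let parent_weight_ge0 v : 0 <= parent_weight v.
Proof.
rewrite mulr_ge0 ?parent_mass_ge0 //.
by have /andP[? ?] := share_bounds v.1.1 v.1.2; case: ifP; rewrite ?subr_ge0.
Qed.

Let sum_parent_weight : \sum_v parent_weight v = zeta x i j.
Proof.
have := sum_split_bool (fun b : K => parent_mass b.1 b.2)
  (fun b : K => share b.1 b.2) (fun _ _ => 1).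
under eq_bigr do rewrite mulr1.
move=> ->; rewrite -sum_parent_mass; apply: eq_bigr => b _.
by rewrite !mulr1 subrKC mulr1.
Qed.

Lemma joint_weight_ge0 u : 0 <= joint_weight u.
Proof.
have zeta_ge0 : 0 <= zeta x i j.
  by case: hx => _ [_ _ [hz _ _]]; case/andP: (hz i j Tij).
exact: divr_ge0 (mulr_ge0 (split_mass_ge0 _ _) (parent_weight_ge0 u.2)) zeta_ge0.
Qed.

Lemma sum_joint_fst (h : K -> R) :
  \sum_u joint_weight u * h u.1 = \sum_(a : K) split_mass a.1 a.2 * h a.
Proof.
exact: (sum_product_fst h (fun a : K => split_mass_ge0 a.1 a.2)
  sum_split_mass sum_parent_weight).
Qed.

(** The bit is kept inside [h], since [chi] and [rho] depend on it; the other parent coordinates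
    average it out in [sum_joint_parent]. *)
Lemma sum_joint_snd (h : K -> bool -> R) :
  \sum_u joint_weight u * h u.2.1 u.2.2 =
  \sum_(b : K) parent_mass b.1 b.2 *
    (share b.1 b.2 * h b true + (1 - share b.1 b.2) * h b false).
Proof.
rewrite -(sum_split_bool (fun b : K => parent_mass b.1 b.2)
  (fun b : K => share b.1 b.2)).
exact: (sum_product_snd (fun v => h v.1 v.2) parent_weight_ge0
  sum_split_mass sum_parent_weight).
Qed.

Lemma sum_joint_weight : \sum_u joint_weight u = zeta x i j.
Proof.
rewrite -sum_split_mass; under eq_bigr do rewrite -[joint_weight _]mulr1.
by rewrite (sum_joint_fst (fun=> 1)); under eq_bigr do rewrite mulr1.
Qed.

Lemma sum_joint_parent (h : K -> R) :
  \sum_u joint_weight u * h u.2.1 = \sum_(b : K) parent_mass b.1 b.2 * h b.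
Proof.
rewrite (sum_joint_snd (fun b _ => h b)); apply: eq_bigr => b _.
by rewrite -mulrDl subrKC mul1r.
Qed.

Lemma joint_point_generator u :
  joint_weight u != 0 -> generators R N i j (joint_point u).
Proof.
case: u => -[k l] [[n m] b]; rewrite /joint_weight /joint_point /=.
(* No generator has this pair of parents; its weight is zero by (Par). Of the remaining cells,
   [m = 0] falls under condition 2, [n = N.+1] under condition 3 and the rest under condition 1. *)
have [/andP[/eqP nN /eqP m0]|root] := boolP ((n == N.+1 :> nat) && (m == 0%N :> nat)).
  by rewrite nN m0 parent_mass_root mul0r mulr0 mul0r => /eqP.
rewrite /split_mass; case: ifP => [kl|_]; last by rewrite !mul0r => /eqP.
rewrite /parent_mass; case: ifP => [nm _|_]; last by rewrite mul0r mulr0 mul0r => /eqP.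
have bit (c : bool) : (c%:R : R) = 0 \/ (c%:R : R) = 1 by case: c; [right | left].
have [m0|m0] := eqVneq (m : nat) 0%N.
  left; left; right; exists n, k, l, (b%:R); rewrite kl; split=> //; first by lia.
  by rewrite m0 /= (_ : (N.+1 == n :> nat) = false) //; lia.
have [nN|nN] := eqVneq (n : nat) N.+1.
  left; right; exists m, k, l, (b%:R); rewrite kl; split=> //; first by lia.
  by rewrite nN.
left; left; left; exists m, n, k, l; rewrite kl; split=> //; lia.
Qed.

(** Apart from the constant [CZeta], every coordinate of [joint_point] is an indicator, so its
    weighted sum is a marginal of the coupling, given by (Split), (Par) or the shares. *)
Lemma subvector_joint : subvector N x i j = \sum_u joint_weight u *: joint_point u.
Proof.
apply/funext => -[c cP]; rewrite fct_sumE /= /subvector /joint_point.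
case: c cP => [|k|l|k l|n|m|n m| |] /= cP.
- rewrite -sum_joint_weight; apply: eq_bigr => u _; exact/esym/mulr1.
- rewrite (sum_joint_fst (fun a => (k == a.1)%:R)) sum_pair_fst; last by lia.
  by rewrite sum_split_mass_l ifT //; lia.
- rewrite (sum_joint_fst (fun a => (l == a.2)%:R)) sum_pair_snd; last by lia.
  by rewrite sum_split_mass_k ifT //; lia.
- rewrite (sum_joint_fst (fun a => ((k == a.1) && (l == a.2))%:R)).
  by rewrite sum_pair_both ?/split_mass ?ifT // /split_ok; lia.
- rewrite (sum_joint_parent (fun b => (n == b.1)%:R)) sum_pair_fst; last by lia.
  by rewrite sum_parent_mass_m ifT //; lia.
- rewrite (sum_joint_parent (fun b => (m == b.2)%:R)) sum_pair_snd; last by lia.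
  by rewrite sum_parent_mass_n ifT //; lia.
- rewrite (sum_joint_parent (fun b => ((n == b.1) && (m == b.2))%:R)).
  by rewrite sum_pair_both ?/parent_mass ?ifT //; lia.
- rewrite (sum_joint_snd (fun b c => ((0%N == b.2) && c)%:R)).
  rewrite -sum_share_chi //; apply: eq_bigr => b _.
  by rewrite andbT andbF mulr0 addr0 mulrA.
- rewrite (sum_joint_snd (fun b c => ((N.+1 == b.1) && c)%:R)).
  rewrite -sum_share_rho //; apply: eq_bigr => b _.
  by rewrite andbT andbF mulr0 addr0 mulrA.
Qed.

End Coupling.

Theorem proposition5 (R : realType) (N : nat) (hN : (2 <= N)%N)
    (x : variables R) (hx : feasible N x) (i j : nat) (hij : in_S N i j) :
  convex_hull (generators R N i j) (subvector N x i j).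
Proof.
rewrite (subvector_joint hx hij); apply: convex_hull_le1.
- by right.
- by move=> u; apply: joint_weight_ge0.
(* The total weight is [zeta x i j], at most 1 by the variable bounds. *)
- rewrite sum_joint_weight //; case: hx => _ [_ _ [hz _ _]].
  by case/andP: hij => /andP[Tij _] _; case/andP: (hz i j Tij).
- by move=> u; apply: joint_point_generator.
Qed.
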